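(* For every grammar with left contexts $G=(\Sigma,N,R,S)$ there exists a grammar with left contexts $G'=(\Sigma,N',R',S')$ in the even-odd normal form that describes the same language, $L(G')=L(G)$. The size of $G'$ is at most sextuple exponential in the size of $G$. If $G$ is in the strong binary normal form, then the size of $G'$ is at most double exponential in the size of $G$.
   Context: **Grammars with left contexts.** A grammar with left contexts is a quadruple $G=(\Sigma,N,R,S)$, where $\Sigma$ is a finite alphabet, $N$ is a finite set of nonterminal symbols disjoint from $\Sigma$, $S\in N$ is the initial symbol, and $R$ is a finite set of rules of the form $$A\to \alpha_1\,\&\,\ldots\,\&\,\alpha_k\,\&\,{\lhd}\beta_1\,\&\,\ldots\,\&\,{\lhd}\beta_m\,\&\,{\trianglelefteq}\gamma_1\,\&\,\ldots\,\&\,{\trianglelefteq}\gamma_n,$$ with $A\in N$, $k\ge 1$, $m,n\ge 0$, $\alpha_i,\beta_i,\gamma_i\in(\Sigma\cup N)^*$. For $u,v\in\Sigma^*$, write $u\langle v\rangle$ for the string $v$ in the left context $u$ (formally a pair $(u,v)$). Propositions $X(u\langle v\rangle)$, with $X\in\Sigma\cup N$, are derived as follows. Axioms: $a(x\langle a\rangle)$ for all $a\in\Sigma$, $x\in\Sigma^*$. Each rule $A\to \alpha_1\,\&\,\ldots\,\&\,\alpha_k\,\&\,{\lhd}\beta_1\,\&\,\ldots\,\&\,{\lhd}\beta_m\,\&\,{\trianglelefteq}\gamma_1\,\&\,\ldots\,\&\,{\trianglelefteq}\gamma_n$ in $R$ allows one to derive $A(u\langle v\rangle)$ from already derived propositions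 if: (i) for every conjunct $\alpha_i=X_1\ldots X_\ell$ there is a partition $v=v_1\ldots v_\ell$ such that $X_j(uv_1\ldots v_{j-1}\langle v_j\rangle)$ is derived for all $j$; (ii) for every conjunct ${\lhd}\beta_i={\lhd}X_1\ldots X_\ell$ there is a partition $u=u_1\ldots u_\ell$ such that $X_j(u_1\ldots u_{j-1}\langle u_j\rangle)$ is derived for all $j$; (iii) for every conjunct ${\trianglelefteq}\gamma_i={\trianglelefteq}X_1\ldots X_\ell$ there is a partition $uv=w_1\ldots w_\ell$ such that $X_j(w_1\ldots w_{j-1}\langle w_j\rangle)$ is derived for all $j$. For $\ell=0$ these conditions mean $v=\varepsilon$, $u=\varepsilon$, $uv=\varepsilon$, respectively. Let $L_G(A)=\{u\langle v\rangle \mid A(u\langle v\rangle)\text{ is derivable}\}$ and $L(G)=\{w\in\Sigma^*\mid \varepsilon\langle w\rangle\in L_G(S)\}$. The size $|G|$ is the total number of symbols used in the description of the grammar. **Even-odd normal form.** $G=(\Sigma,N,R,S)$ is in the even-odd normal form if $S$ does not occur on the right-hand side of any rule, and every rule is of one of the following forms: $A\to B_1a_1C_1\,\&\ldots\&\,B_na_nC_n$ ($n\ge1$, $B_i,C_i\in N$, $a_i\in\Sigma$); $A\to a\,\&\,{\lhd}Db$ ($D\in N$, $a,b\in\Sigma$); $A\to a\,\&\,{\lhd}\varepsilon$ ($a\in\Sigma$); $S\to Aa$ ($A\in N$, $a\in\Sigma$); $S\to\varepsilon$. **Strong binary normal form.** All rules are of one of the forms $A\to B_1C_1\,\&\ldots\&\,B_nC_n$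 ($n\ge1$, $B_i,C_i\in N$); $A\to a\,\&\,{\lhd}D$ ($a\in\Sigma$, $D\in N$); $A\to a\,\&\,{\lhd}\varepsilon$ ($a\in\Sigma$). **Convention.** ''At most $k$-tuple exponential in $|G|$'' means bounded by $2^{2^{\cdot^{\cdot^{2^{p(|G|)}}}}}$ with $k$ twos, for some polynomial $p$ not depending on $G$. *)

(* Defs.v *)
From HB Require Import structures.
From mathcomp Require Import all_boot all_order all_algebra finmap.

Set Implicit Arguments.
Unset Strict Implicit.
Unset Printing Implicit Defensive.

Local Open Scope nat_scope.

(* Terminals and nonterminals are disjoint by construction: the terminal [a] is
   [inl a] and the nonterminal [A] is [inr A]. *)
Notation symbol Sigma N := (Sigma + N)%type (only parsing).

(* [Rule A alphas betas gammas] is the rule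
     A -> alpha_1 & ... & alpha_k & <|beta_1 & ... & <|beta_m
            & <=|gamma_1 & ... & <=|gamma_n,
   where the conjuncts <|beta_i (resp. <=|gamma_i) refer to the left context
   (resp. to the left context followed by the string itself). *)
Record rule (Sigma N : Type) := Rule {
  lhs : N;
  base_conj : seq (seq (symbol Sigma N));
  left_conj : seq (seq (symbol Sigma N));
  ext_conj : seq (seq (symbol Sigma N)) }.

Section RuleChoice.
Variables Sigma N : choiceType.

Definition rule_code (r : rule Sigma N) :=
  (lhs r, base_conj r, left_conj r, ext_conj r).
Definition rule_decode c : rule Sigma N :=
  let: (A, alphas, betas, gammas) := c in Rule A alphas betas gammas.
Lemma rule_codeK : cancel rule_code rule_decode. Proof. by case. Qed.

HB.instance Definition _ := Choice.copy (rule Sigma N) (can_type rule_codeK).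
End RuleChoice.

Record grammar (Sigma : finType) := Grammar {
  nonterm : finType;
  rules : {fset rule Sigma nonterm};
  start : nonterm;
  base_conj_neq0 : forall r, r \in rules -> base_conj r != [::] }.

Section Grammar.
Variable Sigma : finType.
Implicit Types (G : grammar Sigma) (u v w x : seq Sigma).

(* [derives G X u v] is the derivability of X(u<v>), where u<v> is the string v
   in the left context u. [derives_seq G [:: X_1; ...; X_l] u v] states that
   there is a partition v = v_1 ... v_l with every X_j(u v_1 ... v_(j-1) <v_j>)
   derivable. *)
Inductive derives G : symbol Sigma (nonterm G) -> seq Sigma -> seq Sigma -> Prop :=
| derives_axiom a x : derives (inl a) x [:: a]
| derives_rule r u v :
    r \in rules G ->
    (forall alpha, alpha \in base_conj r -> derives_seq alpha u v) ->
    (forall beta, beta \in left_conj r -> derives_seq beta [::] u) ->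
    (forall gamma, gamma \in ext_conj r -> derives_seq gamma [::] (u ++ v)) ->
    derives (inr (lhs r)) u v
with derives_seq G :
    seq (symbol Sigma (nonterm G)) -> seq Sigma -> seq Sigma -> Prop :=
| derives_nil u : derives_seq [::] u [::]
| derives_cons X alpha u v w :
    derives X u v -> derives_seq alpha (u ++ v) w ->
    derives_seq (X :: alpha) u (v ++ w).

Definition lang G w : Prop := derives (inr (start G)) [::] w.

(* Every conjunct is preceded by an arrow or an ampersand, and a context
   conjunct also carries its context operator. *)
Definition rule_size (N : Type) (r : rule Sigma N) : nat :=
  1 + \sum_(alpha <- base_conj r) (1 + size alpha)
    + \sum_(beta <- left_conj r) (2 + size beta)
    + \sum_(gamma <- ext_conj r) (2 + size gamma).

(* All four components are counted: Sigma, N, R and S. *)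
Definition grammar_size G : nat :=
  #|Sigma| + #|nonterm G| + \sum_(r <- rules G) rule_size r + 1.

Inductive even_odd_rule (N : Type) (S : N) : rule Sigma N -> Prop :=
| EvenOddConcat A (s : seq (N * Sigma * N)) :
    s <> [::] ->
    even_odd_rule S
      (Rule A [seq [:: inr t.1.1; inl t.1.2; inr t.2] | t <- s] [::] [::])
| EvenOddCtx A a D b :
    even_odd_rule S (Rule A [:: [:: inl a]] [:: [:: inr D; inl b]] [::])
| EvenOddNoCtx A a :
    even_odd_rule S (Rule A [:: [:: inl a]] [:: [::]] [::])
| EvenOddStart A a :
    even_odd_rule S (Rule S [:: [:: inr A; inl a]] [::] [::])
| EvenOddEmpty :
    even_odd_rule S (Rule S [:: [::]] [::] [::]).

Definition even_odd_nf G : Prop :=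
  forall r, r \in rules G ->
    (forall alpha, alpha \in base_conj r ++ left_conj r ++ ext_conj r ->
       inr (start G) \notin alpha)
    /\ even_odd_rule (start G) r.

Inductive strong_binary_rule (N : Type) : rule Sigma N -> Prop :=
| StrongBinConcat A (s : seq (N * N)) :
    s <> [::] ->
    strong_binary_rule
      (Rule A [seq [:: inr t.1; inr t.2] | t <- s] [::] [::])
| StrongBinCtx A a D :
    strong_binary_rule (Rule A [:: [:: inl a]] [:: [:: inr D]] [::])
| StrongBinNoCtx A a :
    strong_binary_rule (Rule A [:: [:: inl a]] [:: [::]] [::]).

Definition strong_binary_nf G : Prop :=
  forall r, r \in rules G -> strong_binary_rule r.

End Grammar.

(* 2 ^ (2 ^ ... ^ (2 ^ n)) with k twos. *)
Definition tower (k n : nat) : nat := iter k (expn 2) n.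

(* Main.v *)
Require Import Defs.
From mathcomp Require Import all_boot all_order all_algebra finmap.
From mathcomp Require Import boolp.
From mathcomp Require Import zify.

(* In the even-odd normal form the letters of w at odd positions (from 0) act as
   separators, and nonterminals other than S derive the segments w[i..j) with i
   even and j odd. Every segment of w differs from one of these by at most one
   separator on each side, so a nonterminal for w[i..j) records facts of G about
   the four segments with ends in {i-1, i} and {j, j+1}. Every split of such a
   segment strictly inside w[i..j) is next to a separator a, hence is visible in
   some decomposition B a C of w[i..j).

   Contexts need the prefixes ending at i-1, i, j, j+1. The facts about the first
   two are verified by the first letter of w[i..j), via the only available context
   operator <|Db. The facts about the last two are hypotheses: in B a C the
   hypotheses of B are those that C verifies. For i = 0 the hypotheses are
   themselves facts about w[0..j), and are discharged by induction on the height
   of their derivations in G.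

   Only the sets of facts are exponential and the sets of conjuncts B a C doubly
   exponential in |G|, so the double exponential bound holds for every G. *)

Set Implicit Arguments.
Unset Strict Implicit.
Unset Printing Implicit Defensive.

Local Open Scope nat_scope.

(** * Concatenation over an arbitrary relation *)

Section Concatenation.
Variables (Sigma N : finType).
Implicit Types (P Q : Sigma + N -> seq Sigma -> seq Sigma -> Prop).
Implicit Types (alpha : seq (Sigma + N)) (u v : seq Sigma).

(** [P] is a parameter because it stands in turn for derivability, for derivability up to a given
    height, and for the meanings of the new nonterminals. *)
Fixpoint cat_at P alpha u v : Prop :=
  if alpha is X :: alpha' then
    exists v1 v2, [/\ v = v1 ++ v2, P X u v1 & cat_at P alpha' (u ++ v1) v2]
  else v = [::].

Definition rule_step P (r : rule Sigma N) u v : Prop :=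
  [/\ forall alpha, alpha \in base_conj r -> cat_at P alpha u v,
      forall beta, beta \in left_conj r -> cat_at P beta [::] u
    & forall gamma, gamma \in ext_conj r -> cat_at P gamma [::] (u ++ v)].

Lemma cat_at_mono P Q :
  (forall X u v, P X u v -> Q X u v) ->
  forall alpha u v, cat_at P alpha u v -> cat_at Q alpha u v.
Proof.
move=> PQ; elim=> [//|X alpha IH] u v /= [v1 [v2 [-> /PQ HX /IH Ha]]].
by exists v1, v2.
Qed.

Lemma rule_step_mono P Q r u v :
  (forall X u v, P X u v -> Q X u v) -> rule_step P r u v -> rule_step Q r u v.
Proof.
by move=> PQ [b l e]; split=> [a /b|a /l|a /e]; apply: cat_at_mono.
Qed.

Lemma cat_at1 P X u v : cat_at P [:: X] u v <-> P X u v.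
Proof.
split=> [[v1 [v2 [-> HX ->]]]|HX]; first by rewrite cats0.
by exists v, [::]; rewrite cats0.
Qed.
End Concatenation.

(** * Derivations of bounded height *)

Section Derivations.
Variables (Sigma : finType) (G : grammar Sigma).
Local Notation sym := (Sigma + nonterm G)%type.
Implicit Types (P Q : sym -> seq Sigma -> seq Sigma -> Prop).
Implicit Types (X : sym) (alpha : seq sym) (u v w W : seq Sigma).

Fixpoint derives_upto n X u v : Prop :=
  if n is n'.+1 then
    match X with
    | inl a => v = [:: a]
    | inr A => exists r, [/\ r \in rules G, lhs r = A
                           & rule_step (derives_upto n') r u v]
    end
  else False.

Lemma derives_upto_le m n X u v :
  m <= n -> derives_upto m X u v -> derives_upto n X u v.
Proof.
elim: m n X u v => [//|m IH] [//|n] [a|A] u v //= mn [r [rG <- Hr]].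
by exists r; split=> //; apply: rule_step_mono Hr => X u' v'; apply: IH.
Qed.

Lemma cat_at_derives alpha u v :
  cat_at (@derives Sigma G) alpha u v <-> derives_seq alpha u v.
Proof.
split; last by elim=> // X a u1 v1 w1 HX _ IH; exists v1, w1.
elim: alpha u v => [|X alpha IH] u v /=; first by move->; apply: derives_nil.
by move=> [v1 [v2 [-> HX /IH Ha]]]; apply: derives_cons.
Qed.

Lemma derives_step r u v :
  r \in rules G -> rule_step (@derives Sigma G) r u v -> derives (inr (lhs r)) u v.
Proof.
by move=> rG [b l e]; apply: derives_rule => // a; [move/b|move/l|move/e];
  move/cat_at_derives.
Qed.

Lemma derives_upto_sound n X u v : derives_upto n X u v -> derives X u v.
Proof.
elim: n X u v => [//|n IH] [a|A] u v /=; first by move->; apply: derives_axiom.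
by move=> [r [rG <- Hr]]; apply: derives_step => //; apply: rule_step_mono Hr.
Qed.

Lemma uniform_bound (T : eqType) (s : seq T) (P : nat -> T -> Prop) :
  (forall m n x, m <= n -> P m x -> P n x) ->
  (forall x, x \in s -> exists n, P n x) ->
  exists n, forall x, x \in s -> P n x.
Proof.
move=> Pmono; elim: s => [|y s IH] Ps; first by exists 0.
have [|m Pm] := IH; first by move=> x xs; apply: Ps; rewrite inE xs orbT.
have [n Pn] := Ps _ (mem_head y s); exists (maxn m n) => x.
rewrite inE => /predU1P[->|/Pm]; first exact: Pmono (leq_maxr m n) Pn.
exact: Pmono (leq_maxl m n).
Qed.

Scheme derives_mut := Minimality for derives Sort Prop
  with derives_seq_mut := Minimality for derives_seq Sort Prop.

(** A rule has finitely many conjuncts, so the maximum of their heights serves all of them, and the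
    rule itself adds one. *)
Lemma derives_upto_complete X u v :
  derives X u v -> exists n, derives_upto n X u v.
Proof.
have mono m n alpha x y : m <= n ->
    cat_at (derives_upto m) alpha x y -> cat_at (derives_upto n) alpha x y.
  by move=> mn; apply: cat_at_mono => ? ? ?; apply: derives_upto_le.
move: X u v; apply: (derives_mut
  (P0 := fun alpha u v => exists n, cat_at (derives_upto n) alpha u v)).
- by move=> a x; exists 1.
- move=> r u v rG _ Hb _ Hl _ He.
  have bound (T : seq (seq sym)) x y :
      (forall alpha, alpha \in T -> exists n, cat_at (derives_upto n) alpha x y) ->
      exists n, forall alpha, alpha \in T -> cat_at (derives_upto n) alpha x y.
    by apply: uniform_bound => m n alpha; apply: mono.
  have [n1 H1] := bound _ _ _ Hb; have [n2 H2] := bound _ _ _ Hl.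
  have [n3 H3] := bound _ _ _ He.
  exists (maxn n1 (maxn n2 n3)).+1, r; split=> //; split=> a.
  + by move/H1; apply: mono; rewrite leq_maxl.
  + by move/H2; apply: mono; rewrite !leq_max leqnn orbT.
  + by move/H3; apply: mono; rewrite !leq_max leqnn !orbT.
- by move=> u; exists 0.
- move=> X alpha u v w _ [m Hm] _ [n Hn]; exists (maxn m n), v, w; split=> //.
    by apply: derives_upto_le Hm; rewrite leq_maxl.
  by apply: mono Hn; rewrite leq_maxr.
Qed.

Lemma cat_at_complete alpha u v :
  cat_at (@derives Sigma G) alpha u v ->
  exists n, cat_at (derives_upto n) alpha u v.
Proof.
elim: alpha u v => [|X alpha IH] u v /=; first by exists 0.
move=> [v1 [v2 [-> /derives_upto_complete[m Hm] /IH[n Hn]]]].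
exists (maxn m n), v1, v2; split=> //.
  by apply: derives_upto_le Hm; rewrite leq_maxl.
apply: cat_at_mono Hn => X' u' v'; apply: derives_upto_le; exact: leq_maxr.
Qed.

(** * Segments of a string given by positions *)

(* Positions p <= q in W delimit the string W[p..q) in the left context W[0..p);
   the nested [take] makes the dependence on the first q letters of W only
   syntactic. *)
Definition at_pos P W alpha p q : Prop :=
  cat_at P alpha (take p (take q W)) (drop p (take q W)).

Lemma at_pos_prefix P W z alpha p q :
  q <= size W -> at_pos P (W ++ z) alpha p q <-> at_pos P W alpha p q.
Proof. by move=> qW; rewrite /at_pos takel_cat. Qed.

Lemma at_pos_mono P Q W alpha p q :
  (forall X u v, P X u v -> Q X u v) ->
  at_pos P W alpha p q -> at_pos Q W alpha p q.
Proof. by move=> PQ; apply: cat_at_mono. Qed.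

Lemma at_posE P W alpha p q : p <= q ->
  at_pos P W alpha p q <-> cat_at P alpha (take p W) (drop p (take q W)).
Proof. by move=> pq; rewrite /at_pos take_takel. Qed.

Lemma at_pos_cons P W X alpha p k q : p <= k <= q ->
  P X (take p W) (drop p (take k W)) -> at_pos P W alpha k q ->
  at_pos P W (X :: alpha) p q.
Proof.
move=> /andP[pk kq] HX; rewrite !at_posE ?(leq_trans pk) // => Ha.
exists (drop p (take k W)), (drop k (take q W)).
have tkE : take p W ++ drop p (take k W) = take k W.
  by rewrite -(take_takel W pk) cat_take_drop.
split=> //; last by rewrite tkE.
by rewrite -[LHS](cat_take_drop (k - p)) take_drop drop_drop subnK // take_takel.
Qed.

Lemma at_pos_split P W X alpha p q : p <= q <= size W ->
  at_pos P W (X :: alpha) p q ->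
  exists k, [/\ p <= k <= q, P X (take p W) (drop p (take k W))
              & at_pos P W alpha k q].
Proof.
move=> /andP[pq qW]; rewrite at_posE //= => -[v1 [v2 [Ev HX Ha]]].
have sz : size v1 + size v2 = q - p.
  by rewrite -size_cat -Ev size_drop size_takel.
have kq : p + size v1 <= q by lia.
have E1 : v1 = drop p (take (p + size v1) W).
  rewrite addnC -take_drop -(subnK pq) addnC in Ev *.
  by rewrite -[LHS](take_size_cat v2 (erefl _)) -Ev addnC -take_drop take_takel //; lia.
exists (p + size v1); split; first by rewrite leq_addr.
  by rewrite -E1.
rewrite at_posE //.
have -> : take (p + size v1) W = take p W ++ v1.
  by rewrite {2}E1 -{1}(take_takel W (leq_addr (size v1) p)) cat_take_drop.
suff -> : drop (p + size v1) (take q W) = v2 by [].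
by rewrite addnC -drop_drop Ev drop_size_cat.
Qed.

Lemma at_pos1 P V X p q : p <= q <= size V ->
  at_pos P V [:: X] p q <-> P X (take p V) (drop p (take q V)).
Proof.
by move=> /andP[pq _]; rewrite at_posE // cat_at1.
Qed.

(** * The finite list of strings whose derivability is recorded *)

Definition conjuncts (r : rule Sigma (nonterm G)) :=
  base_conj r ++ left_conj r ++ ext_conj r.

(** Suffixes occur because conjuncts are processed from left to right, single symbols because a
    split isolates the first symbol; the empty string is what remains of a single symbol. *)
Definition items : seq (seq sym) :=
  [::] :: [seq [:: X] | X <- enum {: sym}] ++
  flatten [seq flatten [seq [seq drop i alpha | i <- iota 0 (size alpha).+1]
                       | alpha <- conjuncts r] | r <- rules G].

Lemma items_singleton X : [:: X] \in items.
Proof. by rewrite inE mem_cat map_f ?mem_enum ?orbT. Qed.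

Lemma items_drop r alpha i :
  r \in rules G -> alpha \in conjuncts r -> i <= size alpha ->
  drop i alpha \in items.
Proof.
move=> rG ar ia; rewrite inE mem_cat; apply/orP; right; apply/orP; right.
apply/flatten_mapP; exists r => //; apply/flatten_mapP; exists alpha => //.
by apply/mapP; exists i => //; rewrite mem_iota.
Qed.

Lemma items_conjunct r alpha :
  r \in rules G -> alpha \in conjuncts r -> alpha \in items.
Proof. by move=> rG ar; rewrite -(drop0 alpha) (items_drop rG). Qed.

Lemma items_behead X alpha : X :: alpha \in items -> alpha \in items.
Proof.
rewrite inE mem_cat => /orP[//|/orP[/mapP[Y _ [_ ->]]|]]; first exact: mem_head.
move=> /flatten_mapP[r rG /flatten_mapP[beta br /mapP[i]]].
rewrite mem_iota => /andP[_ ib] E.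
have ltib : i < size beta.
  by rewrite ltnNge; apply/negP => /drop_oversize E'; rewrite E' in E.
suff -> : alpha = drop i.+1 beta by apply: items_drop br _.
by move: E; rewrite (drop_nth X) // => -[_ ->].
Qed.

(** A conjunct has one suffix more than it has symbols; the extra one is charged to its arrow or
    ampersand, and the leading empty string to the start symbol. *)
Lemma size_items : size items <= grammar_size G.
Proof.
rewrite /grammar_size /= size_cat size_map -cardE card_sum addn1 ltnS leq_add2l.
rewrite size_flatten sumnE !big_map; apply: leq_sum => r _.
rewrite size_flatten sumnE !big_map !big_cat /= /rule_size -addnA -addnA.
apply: leq_trans (leq_addl 1 _); rewrite ?add0n.
by apply: leq_add; last apply: leq_add; apply: leq_sum => alpha _;
  rewrite size_map size_iota // add2n add1n.
Qed.

(** * Transfer of derivations between two strings *)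

Section Transfer.
Variables (W W' : seq Sigma) (corner : nat -> nat -> Prop) (n : nat).

Hypothesis corner_bounded :
  forall p p', corner p p' -> p <= size W /\ p' <= size W'.
Hypothesis corner_mono : forall p p' q q',
  corner p p' -> corner q q' -> p <= q -> p' <= q'.
Hypothesis corner_letter : forall p p' q',
  corner p p' -> corner p.+1 q' ->
  drop p (take p.+1 W) = drop p' (take q' W').
Hypothesis prefix_transfer : forall p p' gamma,
  corner p p' -> gamma \in items ->
  at_pos (derives_upto n) W gamma 0 p -> at_pos (@derives Sigma G) W' gamma 0 p'.
Hypothesis inner_transfer : forall p p' q q' k,
  corner p p' -> corner q q' -> p < k < q ->
  (exists k', corner k k') \/
  exists k', [/\ p' <= k' <= q',
    forall X, at_pos (derives_upto n.+1) W [:: X] p k ->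
      at_pos (@derives Sigma G) W' [:: X] p' k'
  & forall alpha, alpha \in items -> at_pos (derives_upto n.+1) W alpha k q ->
      at_pos (@derives Sigma G) W' alpha k' q'].

(* A derivation in W between corners is replayed in W': a symbol or conjunct whose
   boundaries are corners is handled by induction, context conjuncts by
   [prefix_transfer], and a conjunct split at an inner position by
   [inner_transfer]. Contexts need one derivation step less than the conclusion;
   this gap is what makes the induction in [derived_triples_prefix] work. *)
Lemma transfer p p' q q' alpha :
  corner p p' -> corner q q' -> p <= q -> alpha \in items ->
  at_pos (derives_upto n.+1) W alpha p q ->
  at_pos (@derives Sigma G) W' alpha p' q'.
Proof.
have upto_mono m m' (V : seq Sigma) beta x y : m <= m' ->
    at_pos (derives_upto m) V beta x y -> at_pos (derives_upto m') V beta x y.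
  by move=> mm'; apply: at_pos_mono => ? ? ?; apply: derives_upto_le.
(* Only the height of the given derivation becomes [m <= n.+1]; the section hypotheses keep [n].
   Induction on [m] descends into rules, the inner induction on [alpha] runs along a conjunct. *)
move: (leqnn n.+1); move: {1 3}n.+1 => m.
elim: m p p' q q' alpha => [|m IHm] p p' q q' alpha mn.
  move=> cp cq pq _; have [_ q'W] := corner_bounded cq; have [qW _] := corner_bounded cq.
  case: alpha => [|X alpha].
    rewrite !at_posE ?(corner_mono cp cq) //= => E.
    have {}E : p = q.
      by move/(congr1 size): E; rewrite size_drop size_takel //=; lia.
    suff -> : p' = q' by rewrite drop_oversize // size_takel.
    by subst q; apply/eqP; rewrite eqn_leq (corner_mono cp cq) ?(corner_mono cq cp).
  by move/at_pos_split => [|k []//]; rewrite pq.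
have sym_transfer p1 p1' q1 q1' X : corner p1 p1' -> corner q1 q1' -> p1 <= q1 ->
    derives_upto m.+1 X (take p1 W) (drop p1 (take q1 W)) ->
    derives X (take p1' W') (drop p1' (take q1' W')).
  move=> cp cq pq; have [qW q'W] := corner_bounded cq.
  case: X => [a|A] /=.
    move=> E; have Eq : q1 = p1.+1.
      by move/(congr1 size): E; rewrite size_drop size_takel //=; lia.
    by subst q1; rewrite -(corner_letter cp cq) E; apply: derives_axiom.
  move=> [r [rG <- [Hb Hl He]]]; apply: derives_step => //.
  have tE V x y : x <= y -> take x V ++ drop x (take y V) = take y V :> seq Sigma.
    by move=> xy; rewrite -(take_takel V xy) cat_take_drop.
  have mem_r a : a \in base_conj r \/ a \in left_conj r \/ a \in ext_conj r ->
      a \in items.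
    by move=> H; apply: items_conjunct rG _; rewrite !mem_cat;
      case: H => [|[]] ->; rewrite ?orbT.
  have p'q' := corner_mono cp cq pq.
  have prefE P V x beta : at_pos P V beta 0 x <-> cat_at P beta [::] (take x V).
    by rewrite at_posE // take0 drop0.
  split=> beta.
  - move=> br; rewrite -at_posE //; apply: (IHm _ _ _ _ _ _ cp cq pq) => //.
      exact: ltnW.
      by apply: mem_r; left.
    by apply/at_posE => //; apply: Hb.
  - move=> br; rewrite -prefE; apply: (prefix_transfer cp).
      by apply: mem_r; right; left.
    by apply: (@upto_mono m) => //; rewrite prefE; apply: Hl.
  - move=> br; rewrite tE // -prefE; apply: (prefix_transfer cq).
      by apply: mem_r; right; right.
    by apply: (@upto_mono m) => //; rewrite prefE -(tE _ _ _ pq); apply: He.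
elim: alpha p p' => [|X alpha IHa] p p' cp cq pq aQ.
  move=> H; apply: (IHm _ _ _ _ _ _ cp cq pq aQ); first exact: ltnW.
  exact: H.
have [qW q'W] := corner_bounded cq; have p'q' := corner_mono cp cq pq.
move/at_pos_split => [|k [/andP[pk kq] HX Ha]]; first by rewrite pq.
have corner_case k' : corner k k' -> at_pos (@derives Sigma G) W' (X :: alpha) p' q'.
  move=> ck; apply: (@at_pos_cons _ _ _ _ _ k').
  - by rewrite (corner_mono cp ck) // (corner_mono ck cq).
  - exact: sym_transfer cp ck pk HX.
  - by apply: (IHa _ _ ck cq kq) Ha; apply: items_behead aQ.
have [E|kp] := eqVneq k p; first by apply: (corner_case p'); rewrite E.
have [E|kq'] := eqVneq k q; first by apply: (corner_case q'); rewrite E.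
have pkq : p < k < q by lia.
have [[k' ck]|[k' [/andP[p'k' k'q'] HX' Ha']]] := inner_transfer cp cq pkq.
  exact: corner_case ck.
apply: (@at_pos_cons _ _ _ _ _ k'); first by rewrite p'k'.
  rewrite -at_pos1 ?p'k' ?(leq_trans k'q') //; apply: HX'.
  rewrite at_pos1 ?pk ?(leq_trans kq) //; apply: derives_upto_le HX.
  exact: mn.
apply: Ha'; first exact: items_behead aQ.
exact: upto_mono Ha.
Qed.

End Transfer.
End Derivations.

(** * Sets of facts about segments *)

Section Construction.
Variables (Sigma : finType) (G : grammar Sigma).
Local Notation sym := (Sigma + nonterm G)%type.
Local Notation item_index := 'I_(size (items G)).
Local Notation derivable := (@derives Sigma G).
Local Notation upto n := (@derives_upto Sigma G n).
Implicit Types (P Q : sym -> seq Sigma -> seq Sigma -> Prop).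
Implicit Types (u v w : seq Sigma) (x y a : Sigma).

Definition item (i : item_index) : seq sym := nth [::] (items G) i.

Lemma itemP alpha : alpha \in items G -> exists i, item i = alpha.
Proof.
by move=> /(nthP [::])[i lt_i <-]; exists (Ordinal lt_i).
Qed.

Lemma item_in i : item i \in items G. Proof. exact: mem_nth. Qed.

(* The boolean tells whether the fact is about v or about vy. *)
Definition prefix_facts P v y : {set bool * item_index} :=
  [set c | `[< at_pos P (rcons v y) (item c.2) 0 (size v + nat_of_bool c.1) >]].

(* The facts about u<v> with the string possibly extended by the last letter of u
   on the left (first boolean) and by y on the right (second boolean). For empty u
   the truncated subtraction makes the first boolean irrelevant. *)
Definition facts P u v y : {set bool * bool * item_index} :=
  [set c | `[< at_pos P (u ++ rcons v y) (item c.2)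
                 (size u - nat_of_bool c.1.1) (size u + size v + nat_of_bool c.1.2) >]].

Lemma prefix_factsP P Q v y v' y' :
  prefix_facts P v y \subset prefix_facts Q v' y' <->
  forall alpha (c : bool), alpha \in items G ->
    at_pos P (rcons v y) alpha 0 (size v + c) ->
    at_pos Q (rcons v' y') alpha 0 (size v' + c).
Proof.
split=> [/subsetP s alpha c /itemP[i <-] H|s].
  by have := s (c, i); rewrite !inE => /(_ (asboolT H))/asboolP.
by apply/subsetP => -[c i]; rewrite !inE /= => /asboolP H; apply: asboolT;
  apply: s H; apply: item_in.
Qed.

Lemma factsP P Q u v y u' v' y' :
  facts P u v y \subset facts Q u' v' y' <->
  forall alpha (c1 c2 : bool), alpha \in items G ->
    at_pos P (u ++ rcons v y) alpha (size u - c1) (size u + size v + c2) ->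
    at_pos Q (u' ++ rcons v' y') alpha (size u' - c1) (size u' + size v' + c2).
Proof.
split=> [/subsetP s alpha c1 c2 /itemP[i <-] H|s].
  by have := s (c1, c2, i); rewrite !inE => /(_ (asboolT H))/asboolP.
by apply/subsetP => -[[c1 c2] i]; rewrite !inE /= => /asboolP H; apply: asboolT;
  apply: s H; apply: item_in.
Qed.

Lemma prefix_facts_facts P Q v y v' y' :
  facts P [::] v y \subset facts Q [::] v' y' ->
  prefix_facts P v y \subset prefix_facts Q v' y'.
Proof.
move=> /factsP s; apply/prefix_factsP => alpha c aQ.
exact: (s alpha false c aQ).
Qed.

Lemma prefix_facts_mono P Q v y :
  (forall X u v, P X u v -> Q X u v) ->
  prefix_facts P v y \subset prefix_facts Q v y.
Proof. by move=> PQ; apply/prefix_factsP => alpha c _; apply: at_pos_mono. Qed.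

(** Inclusion in one direction is the right notion throughout: without negation, a grammar can
    confirm facts but not refute them. *)
Definition same_left u u' : Prop :=
  (u = [::] /\ u' = [::]) \/
  exists u1 u1' x, [/\ u = rcons u1 x, u' = rcons u1' x
    & prefix_facts derivable u1 x \subset prefix_facts derivable u1' x].

Definition splits_transfer n u v y u' v' : Prop :=
  forall v1 a v2, v = v1 ++ a :: v2 -> odd (size v1) -> odd (size v2) ->
  exists v1' v2', [/\ v' = v1' ++ a :: v2',
    facts (upto n.+1) u v1 a \subset facts derivable u' v1' a
  & facts (upto n.+1) (rcons (u ++ v1) a) v2 y
      \subset facts derivable (rcons (u' ++ v1') a) v2' y].

(** The corners are the ends of [v] and their outer neighbours. Any other position between them is
    inside [v] and touches a separator [a], so what lies on its two sides is recorded in the facts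
    of the two halves at [a]. A single letter has no such position. *)
Lemma facts_transfer n u v y u' v' :
  odd (size v) -> same_left u u' ->
  prefix_facts (upto n) (u ++ v) y \subset prefix_facts derivable (u' ++ v') y ->
  (exists a, v = [:: a] /\ v' = [:: a]) \/
    (1 < size v /\ splits_transfer n u v y u' v') ->
  facts (upto n.+1) u v y \subset facts derivable u' v' y.
Proof.
move=> odd_v left_u /prefix_factsP right_v cases.
have v_gt0 : 0 < size v by case: (v) odd_v.
have v'_gt0 : 0 < size v'.
  case: cases => [[a [_ ->]]//|[]].
  case: (v) odd_v => [//|b [//|a v2]] /=; rewrite negbK => odd_v2 _.
  move=> /(_ [:: b] a v2 erefl erefl odd_v2) [v1' [v2' [-> _ _]]].
  by rewrite size_cat addnS.
have u0 : size u = 0 <-> size u' = 0.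
  by case: left_u => [[-> ->]//|[u1 [u1' [x [-> -> _]]]]]; rewrite !size_rcons.
pose corner p p' := (exists c : bool, p = size u - c /\ p' = size u' - c) \/
  (exists c : bool, p = size u + size v + c /\ p' = size u' + size v' + c).
apply/factsP => alpha c1 c2 aQ.
apply: (@transfer _ G _ _ corner n) => //.
- by move=> p p' [[[] [-> ->]]|[[] [-> ->]]]; rewrite !size_cat !size_rcons; lia.
- by move=> p p' q q' [[[] [-> ->]]|[[] [-> ->]]] [[[] [-> ->]]|[[] [-> ->]]]; lia.
- move=> p p' q' cp cq.
  suff [s [a [t [s' [t' [-> -> -> -> ->]]]]]] : exists s a t s' t',
      [/\ u ++ rcons v y = s ++ a :: t, u' ++ rcons v' y = s' ++ a :: t',
          p = size s, p' = size s' & q' = (size s').+1].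
    have letter (z z' : seq Sigma) :
        drop (size z) (take (size z).+1 (z ++ a :: z')) = [:: a].
      by rewrite -cat_rcons take_size_cat ?size_rcons // -cats1 drop_size_cat.
    by rewrite !letter.
  (* Two corners are adjacent only across the last letter of [u], across [y], or across a one-letter
     [v]. *)
  have : [\/ [/\ 0 < size u, p = size u - 1, p' = size u' - 1 & q' = size u'],
      [/\ p = size u + size v, p' = size u' + size v' & q' = p'.+1] |
      [/\ p = size u, p' = size u', size v = 1 & q' = size u' + size v']].
    case: cp cq => [[[] [-> ->]]|[[] [-> ->]]] [[[] [E ->]]|[[] [E ->]]];
      try by exfalso; lia.
    - by constructor 1; split; lia.
    - by constructor 3; split; lia.
    - by constructor 3; split; lia.
    - by constructor 2; split; lia.
  case=> [[u_gt0 -> -> ->]|[-> -> ->]|[-> -> v1 ->]].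
  - case: left_u => [[E _]|[u1 [u1' [x [-> -> _]]]]]; first by rewrite E in u_gt0.
    exists u1, x, (rcons v y), u1', (rcons v' y).
    by rewrite !cat_rcons !size_rcons !subn1.
  - by exists (u ++ v), y, [::], (u' ++ v'), [::]; rewrite -!cats1 -!catA !size_cat.
  - case: cases => [[a [-> ->]]|[]]; last by rewrite v1.
    by exists u, a, [:: y], u', [:: y]; rewrite addn1.
- move=> p p' gamma [[c [-> ->]]|[c [-> ->]]] gQ.
    case: left_u => [[-> ->]|[u1 [u1' [x [-> -> /prefix_factsP left_x]]]]].
      rewrite /= !sub0n /at_pos !take0; apply: cat_at_mono => ? ? ?.
      exact: derives_upto_sound.
    (* [facts] counts back from the end of the left context, [prefix_facts] forward from before its
       last letter; hence the negated boolean. *)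
    have sizeE (s : seq Sigma) : size (rcons s x) - c = size s + ~~ c.
      by rewrite size_rcons; case: (c); lia.
    rewrite !sizeE !at_pos_prefix; try by rewrite size_rcons; case: (c); lia.
    move=> H; apply: left_x => //; apply: at_pos_mono H => ? ? ?.
    exact: derives_upto_sound.
  rewrite -!cats1 !catA !cats1 -!size_cat; exact: right_v.
- move=> p p' q q' k cp cq pkq.
  have [ku|ku] := eqVneq k (size u).
    by left; exists (size u'); left; exists false; rewrite !subn0.
  have [kuv|kuv] := eqVneq k (size u + size v).
    by left; exists (size u' + size v'); right; exists false; rewrite !addn0.
  right.
  have lt_u_k : size u < k.
    by case: cp pkq => [[[] [-> _]]|[[] [-> _]]]; lia.
  have lt_k_uv : k < size u + size v.
    by case: cq pkq => [[[] [-> _]]|[[] [-> _]]]; lia.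
  case: cases => [[a [Ev _]]|[_ Hsplit]]; first by rewrite Ev /= in lt_k_uv; lia.
  have [b1 [Ep Ep']] : exists c : bool, p = size u - c /\ p' = size u' - c.
    by case: cp pkq => // -[c [-> _]]; lia.
  have [b2 [Eq Eq']] : exists c : bool,
      q = size u + size v + c /\ q' = size u' + size v' + c.
    by case: cq pkq => // -[c [-> _]]; lia.
  (* The separator comes right after position [k] if [d] is odd and right before it if [d] is even;
     [e] tells which. *)
  pose d := k - size u; pose e := ~~ odd d.
  pose v1 := take (d - e) v.
  have [a [v2 Ev]] : exists a v2, v = v1 ++ a :: v2.
    exists (nth y v (d - e)), (drop (d - e).+1 v).
    by rewrite -drop_nth ?cat_take_drop //; rewrite /d; lia.
  have sz1 : size v1 = d - e by rewrite size_takel // /d; lia.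
  have szv : size v = (size v1 + size v2).+1 by rewrite {1}Ev size_cat addnS.
  have odd1 : odd (size v1).
    by rewrite sz1 /e; case odd_d: (odd d) => /=; move: odd_d; rewrite /d; lia.
  have odd2 : odd (size v2) by move: odd_v; rewrite szv /= oddD odd1 /= negbK.
  have [v1' [v2' [Ev' /factsP H1 /factsP H2]]] := Hsplit _ _ _ Ev odd1 odd2.
  have szv' : size v' = (size v1' + size v2').+1 by rewrite Ev' size_cat addnS.
  have Ek : k = size u + size v1 + e by rewrite sz1 /d; move: sz1 odd1; rewrite /d; lia.
  exists (size u' + size v1' + e); rewrite Ep' Eq' Ep Eq Ek; split.
  + by rewrite szv'; lia.
  + move=> X.
    have WE (s s1 s2 t : seq Sigma) : t = s1 ++ a :: s2 ->
        s ++ rcons t y = (s ++ rcons s1 a) ++ rcons s2 y.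
      by move->; rewrite -!cats1 -!catA.
    rewrite (WE _ _ _ _ Ev) (WE _ _ _ _ Ev').
    rewrite (@at_pos_prefix _ _ _ (u ++ rcons v1 a)); last first.
      by rewrite size_cat size_rcons; lia.
    rewrite (@at_pos_prefix _ _ _ (u' ++ rcons v1' a)); last first.
      by rewrite size_cat size_rcons; lia.
    by apply: H1; apply: items_singleton.
  + move=> beta bQ.
    have WE (s s1 s2 t : seq Sigma) : t = s1 ++ a :: s2 ->
        s ++ rcons t y = rcons (s ++ s1) a ++ rcons s2 y.
      by move->; rewrite -!cats1 -!catA.
    rewrite (WE _ _ _ _ Ev) (WE _ _ _ _ Ev').
    (* The right half has to be extended over the separator exactly when [k] precedes it. *)
    have := H2 beta (~~ e) b2 bQ.
    have E1 (s s1 : seq Sigma) : size (rcons (s ++ s1) a) - ~~ e = size s + size s1 + e.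
      by rewrite size_rcons size_cat; case: (e); lia.
    have E2 (s s1 s2 t : seq Sigma) : t = s1 ++ a :: s2 ->
        size (rcons (s ++ s1) a) + size s2 + b2 = size s + size t + b2.
      by move->; rewrite size_rcons !size_cat /=; lia.
    by rewrite !E1 (E2 _ _ _ _ Ev) (E2 _ _ _ _ Ev').
- by left; exists c1.
- by right; exists c2.
- lia.
Qed.

(** * The new grammar and its normal form *)

Definition left_info := option (Sigma * {set bool * item_index}).

Definition phrase : finType :=
  (left_info * Sigma * {set bool * item_index} * {set bool * bool * item_index})%type.

Definition left_ok (l : left_info) u : Prop :=
  if l is Some (x, T) then
    exists u1, u = rcons u1 x /\ T \subset prefix_facts derivable u1 x
  else u = [::].

(* (l, y, H, F): the left context is as described by l and, if y is the next
   letter and the facts H hold for the prefixes ending before and after it,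
   then the facts F hold. *)
Definition meaning (m : phrase) u v : Prop :=
  let: (l, y, H, F) := m in
  left_ok l u /\
  (H \subset prefix_facts derivable (u ++ v) y -> F \subset facts derivable u v y).

(** [None] is the new start symbol; it is constrained in the empty left context only, the one that
    defines the language. *)
Definition sym_meaning (X : Sigma + option phrase) u v : Prop :=
  match X with
  | inl a => v = [:: a]
  | inr None => u = [::] -> derivable (inr (start G)) [::] v
  | inr (Some m) => meaning m u v
  end.

Definition sound_rule (r : rule Sigma (option phrase)) : Prop :=
  forall u v, rule_step sym_meaning r u v -> sym_meaning (inr (lhs r)) u v.

Definition triple_conj (t : phrase * Sigma * phrase) : seq (Sigma + option phrase) :=
  [:: inr (Some t.1.1); inl t.1.2; inr (Some t.2)].

Definition concat_rule (c : option phrase * {set phrase * Sigma * phrase}) :=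
  Rule c.1 [seq triple_conj t | t <- enum c.2] [::] [::].
Definition ctx_rule (c : option phrase * Sigma * phrase * Sigma) :
    rule Sigma (option phrase) :=
  Rule c.1.1.1 [:: [:: inl c.1.1.2]] [:: [:: inr (Some c.1.2); inl c.2]] [::].
Definition no_ctx_rule (c : option phrase * Sigma) : rule Sigma (option phrase) :=
  Rule c.1 [:: [:: inl c.2]] [:: [::]] [::].
Definition start_rule (c : phrase * Sigma) : rule Sigma (option phrase) :=
  Rule None [:: [:: inr (Some c.1); inl c.2]] [::] [::].
Definition empty_rule : rule Sigma (option phrase) := Rule None [:: [::]] [::] [::].

(** Taking sets of triples as conjuncts keeps the family finite; right-hand sides use [phrase] only,
    so the start symbol cannot occur there. *)
Definition candidates : seq (rule Sigma (option phrase)) :=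
  [seq concat_rule c | c <- enum [pred c | c.2 != set0]] ++
  [seq ctx_rule c | c <- enum {: option phrase * Sigma * phrase * Sigma}] ++
  [seq no_ctx_rule c | c <- enum {: option phrase * Sigma}] ++
  [seq start_rule c | c <- enum {: phrase * Sigma}] ++ [:: empty_rule].

Lemma candidates_ind (K : rule Sigma (option phrase) -> Prop) :
  (forall A (T : {set phrase * Sigma * phrase}), T != set0 -> K (concat_rule (A, T))) ->
  (forall c, K (ctx_rule c)) -> (forall c, K (no_ctx_rule c)) ->
  (forall c, K (start_rule c)) -> K empty_rule ->
  forall r, r \in candidates -> K r.
Proof.
move=> K1 K2 K3 K4 K5 r; rewrite !mem_cat inE.
case/or4P=> [/mapP[[A T]]|/mapP[c _ ->]|/mapP[c _ ->]|/orP[/mapP[c _ ->]|/eqP->]] //.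
by rewrite mem_enum inE /= => T0 ->; apply: K1.
Qed.

(* Soundness of the new grammar is thus built in; what has to be proved is that
   there are enough sound rules. *)
Definition sound_rules : {fset rule Sigma (option phrase)} :=
  seq_fset tt [seq r <- candidates | `[< sound_rule r >]].

Lemma mem_sound_rules r :
  (r \in sound_rules) = (r \in candidates) && `[< sound_rule r >].
Proof. by rewrite seq_fsetE mem_filter andbC. Qed.

Lemma sound_rules_neq0 r : r \in sound_rules -> base_conj r != [::].
Proof.
rewrite mem_sound_rules => /andP[rc _]; move: r rc.
apply: candidates_ind => // A T /set0Pn[t tT] /=.
have : triple_conj t \in [seq triple_conj t | t <- enum T].
  by apply: map_f; rewrite mem_enum.
by case: [seq _ | _ <- _].
Qed.

Definition even_odd : grammar Sigma := Grammar None sound_rules_neq0.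

Lemma even_odd_normal : even_odd_nf even_odd.
Proof.
move=> r; rewrite mem_sound_rules => /andP[+ _]; move: r.
apply: candidates_ind => [A T T0|[[[A a] D] b]|[A a]|[B a]|]; split;
  try by [move=> alpha; rewrite !inE => /eqP-> | constructor].
- by move=> alpha; rewrite /= !cats0 => /mapP[t _ ->].
- rewrite /concat_rule /=.
  have -> : [seq triple_conj t | t <- enum T] =
      [seq [:: inr t.1.1; inl t.1.2; inr t.2]
         | t <- [seq (Some t.1.1, t.1.2, Some t.2) | t <- enum T]].
    by rewrite -map_comp; apply: eq_map => -[[]].
  constructor; apply/eqP; rewrite -size_eq0 size_map -cardE -lt0n.
  by apply/card_gt0P/set0Pn.
- by move=> alpha; rewrite !inE => /orP[]/eqP->.
- by move=> alpha; rewrite !inE => /orP[]/eqP->.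
Qed.

(** * Soundness, and applying sound rules *)

Local Notation derives' := (@derives Sigma even_odd).

Lemma even_odd_sound X u v : derives' X u v -> sym_meaning X u v.
Proof.
move=> /derives_upto_complete[n]; elim: n X u v => [//|n IH] [a|A] u v //.
move=> [r [+ <- Hr]]; rewrite mem_sound_rules => /andP[_ /asboolP].
by apply; apply: rule_step_mono Hr.
Qed.

Lemma even_odd_derives r u v : r \in candidates -> sound_rule r ->
  rule_step derives' r u v -> derives' (inr (lhs r)) u v.
Proof.
move=> rc rs; apply: (@derives_step _ even_odd).
by rewrite mem_sound_rules rc; apply/asboolP.
Qed.

Lemma cat_at_triple K t u v : cat_at K (triple_conj t) u v <->
  exists v1 v2 v3, [/\ v = v1 ++ v2 ++ v3, K (inr (Some t.1.1)) u v1,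
    K (inl t.1.2) (u ++ v1) v2 & K (inr (Some t.2)) (u ++ v1 ++ v2) v3].
Proof.
split=> [[v1 [w [-> H1 [v2 [w' [-> H2 /cat_at1 H3]]]]]]|].
  by exists v1, v2, w'; split=> //; rewrite catA.
move=> [v1 [v2 [v3 [-> H1 H2 H3]]]]; exists v1, (v2 ++ v3); split=> //.
by exists v2, v3; split=> //; apply/cat_at1; rewrite -catA.
Qed.

Definition triple_at (K : phrase -> seq Sigma -> seq Sigma -> Prop)
    (t : phrase * Sigma * phrase) u v : Prop :=
  exists v1 v2, [/\ v = v1 ++ t.1.2 :: v2, K t.1.1 u v1
                  & K t.2 (rcons (u ++ v1) t.1.2) v2].

(* Taking all the triples that can be derived makes the rule applicable for
   free, and its soundness is easiest to prove with the largest set. *)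
Definition derived_triples u v : {set phrase * Sigma * phrase} :=
  [set t | `[< triple_at (fun m => derives' (inr (Some m))) t u v >]].

Lemma concat_derives A u v :
  derived_triples u v != set0 ->
  (forall u' v', (forall t, t \in derived_triples u v -> triple_at meaning t u' v') ->
    sym_meaning (inr A) u' v') ->
  derives' (inr A) u v.
Proof.
move=> T0 Tsound; apply: (@even_odd_derives (concat_rule (A, _))).
- by rewrite mem_cat map_f // mem_enum inE; apply: T0.
- move=> u' v' [H _ _]; apply: Tsound => t tT.
  have /cat_at_triple : cat_at sym_meaning (triple_conj t) u' v'.
    by apply: H; apply: map_f; rewrite mem_enum.
  move=> [v1 [v2 [v3 [-> H1 -> H3]]]]; exists v1, v3.
  by split=> //; move: H3; rewrite /= catA cats1.
- split=> // alpha /mapP[t]; rewrite mem_enum inE => /asboolP[v1 [v2 [-> H1 H2]]] ->.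
  apply/cat_at_triple; exists v1, [:: t.1.2], v2; split=> //.
    exact: derives_axiom.
  by rewrite catA cats1.
Qed.

(** * Completeness: enough phrases are derived *)

Definition left_exact (l : left_info) u : Prop :=
  if l is Some (x, T) then
    exists u1, u = rcons u1 x /\ T = prefix_facts derivable u1 x
  else u = [::].

Lemma left_exact_same l u u' : left_exact l u -> left_ok l u' -> same_left u u'.
Proof.
case: l => [[x T] [u1 [-> ->]] [u1' [-> sub]]|-> ->]; last by left.
by right; exists u1, u1', x.
Qed.

(** The facts promised may be one step higher than those assumed, the gap that [transfer] allows.
    Every height [n] gives its own phrase. *)
Definition exact_phrase l n u v y : phrase :=
  (l, y, prefix_facts (upto n) (u ++ v) y, facts (upto n.+1) u v y).

(** The empty set of hypotheses makes this phrase unconditional, as a context operator or the start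
    symbol needs. *)
Definition prefix_phrase v y : phrase := (None, y, set0, facts derivable [::] v y).

Definition splits_derived l u v y : Prop :=
  forall v1 a v2 n, v = v1 ++ a :: v2 -> odd (size v1) -> odd (size v2) ->
  let l' := Some (a, prefix_facts derivable (u ++ v1) a) in
  derives' (inr (Some (exact_phrase l n u v1 a))) u v1 /\
  derives' (inr (Some (exact_phrase l' n (rcons (u ++ v1) a) v2 y)))
    (rcons (u ++ v1) a) v2.

Lemma derived_triples_exact l u v y v1 a v2 n :
  splits_derived l u v y -> v = v1 ++ a :: v2 -> odd (size v1) -> odd (size v2) ->
  (exact_phrase l n u v1 a, a,
   exact_phrase (Some (a, prefix_facts derivable (u ++ v1) a)) n
     (rcons (u ++ v1) a) v2 y) \in derived_triples u v.
Proof.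
move=> D Ev odd1 odd2; rewrite inE; apply: asboolT.
by exists v1, v2; have [] := D _ _ _ n Ev odd1 odd2.
Qed.

Lemma odd_split v : odd (size v) -> 1 < size v ->
  exists v1 a v2, [/\ v = v1 ++ a :: v2, odd (size v1) & odd (size v2)].
Proof.
case: v => [//|b [//|a v2]] /=; rewrite negbK => odd2 _.
by exists [:: b], a, v2.
Qed.

Lemma derived_triples_neq0 l u v y :
  splits_derived l u v y -> odd (size v) -> 1 < size v ->
  derived_triples u v != set0.
Proof.
move=> D odd_v /(odd_split odd_v)[v1 [a [v2 [Ev odd1 odd2]]]].
by apply/set0Pn; eexists; apply: (derived_triples_exact 0 D Ev odd1 odd2).
Qed.

(** The left information of the right phrase in a triple confirms the hypotheses of the left phrase;
    the hypotheses of the right phrase are those assumed at the end of the whole segment. *)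
Lemma derived_triples_meaning l u v y u' v' :
  splits_derived l u v y -> odd (size v) -> 1 < size v ->
  (forall t, t \in derived_triples u v -> triple_at meaning t u' v') ->
  left_ok l u' /\ forall n,
    prefix_facts (upto n) (u ++ v) y \subset prefix_facts derivable (u' ++ v') y ->
    splits_transfer n u v y u' v'.
Proof.
move=> D odd_v v_gt1 T; split=> [|n right_v v1 a v2 Ev odd1 odd2].
  have [v1 [a [v2 [Ev odd1 odd2]]]] := odd_split odd_v v_gt1.
  by have [v1' [v2' [_ []]]] := T _ (derived_triples_exact 0 D Ev odd1 odd2).
have [v1' [v2' [Ev' [_ HB] [[w [Ew left_sub]] HC]]]] :=
  T _ (derived_triples_exact n D Ev odd1 odd2).
have {}Ew : w = u' ++ v1' by case/rcons_inj: Ew.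
rewrite {}Ew in left_sub; exists v1', v2'; split; first exact: Ev'.
  apply: HB; apply: subset_trans left_sub.
  by apply: prefix_facts_mono => ? ? ?; apply: derives_upto_sound.
by apply: HC; move: right_v; rewrite Ev Ev' !cat_rcons -!catA.
Qed.

(** At height 0 no symbol is derivable, and the empty item would describe an empty prefix. *)
Lemma prefix_facts_upto0 v y (T : {set bool * item_index}) :
  0 < size v -> prefix_facts (upto 0) v y \subset T.
Proof.
move=> v_gt0; apply/subsetP => -[c i]; rewrite inE => /asboolP /=.
case: (item i) => [|X alpha].
  by rewrite at_posE // drop0 /= => /(congr1 size); rewrite size_takel ?size_rcons /=;
    case: c; lia.
by move=> /at_pos_split[|k []//]; rewrite size_rcons; case: c => /=; lia.
Qed.

(** The set of triples contains exact phrases of all heights. Prefix facts of height [n] yield facts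
    of height [n.+1], which include the prefix facts of that height; the induction starts vacuously
    at 0. *)
Lemma derived_triples_prefix v y u' v' :
  splits_derived None [::] v y -> odd (size v) -> 1 < size v ->
  (forall t, t \in derived_triples [::] v -> triple_at meaning t u' v') ->
  u' = [::] /\ facts derivable [::] v y \subset facts derivable [::] v' y.
Proof.
move=> D odd_v v_gt1 T.
have [/= u'0 splits] := derived_triples_meaning D odd_v v_gt1 T.
rewrite {}u'0 in T splits *; split=> //.
have step n : prefix_facts (upto n) v y \subset prefix_facts derivable v' y ->
    facts (upto n.+1) [::] v y \subset facts derivable [::] v' y.
  move=> right_v; apply: facts_transfer => //; first by left.
  by right; split=> //; apply: splits.
have all_n n : prefix_facts (upto n) v y \subset prefix_facts derivable v' y.
  elim: n => [|n /step/prefix_facts_facts//].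
  by apply: prefix_facts_upto0; apply: ltnW.
apply/factsP => alpha c1 c2 aQ /cat_at_complete[n Hn].
move/factsP: (step n (all_n n)); apply=> //.
by apply: at_pos_mono Hn => ? ? ?; apply: derives_upto_le.
Qed.

Lemma ctx_candidate c : ctx_rule c \in candidates.
Proof. by rewrite !mem_cat map_f ?mem_enum ?orbT. Qed.

Lemma no_ctx_candidate c : no_ctx_rule c \in candidates.
Proof. by rewrite !mem_cat map_f ?mem_enum ?orbT. Qed.

Lemma start_candidate c : start_rule c \in candidates.
Proof. by rewrite !mem_cat map_f ?mem_enum ?orbT. Qed.

Lemma empty_candidate : empty_rule \in candidates.
Proof. by rewrite !mem_cat mem_head !orbT. Qed.

Lemma facts_letter l n u u' a y :
  left_exact l u -> left_ok l u' ->
  meaning (exact_phrase l n u [:: a] y) u' [:: a].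
Proof.
move=> lu lu'; split=> // right_a; apply: facts_transfer => //.
  exact: left_exact_same lu lu'.
by left; exists a.
Qed.

(** The rule applies to a single string in a single context, so its soundness is the one instance
    assumed. *)
Lemma no_ctx_derives A a : sym_meaning (inr A) [::] [:: a] ->
  derives' (inr A) [::] [:: a].
Proof.
move=> HA; apply: (@even_odd_derives (no_ctx_rule (A, a))).
- exact: no_ctx_candidate.
- move=> u v [Hb Hl _].
  have /(cat_at1 sym_meaning (inl a)) -> := Hb _ (mem_head _ _).
  by have -> := Hl _ (mem_head _ _).
- split=> // alpha; rewrite inE => /eqP-> //.
  by apply/cat_at1; apply: derives_axiom.
Qed.

Lemma ctx_derives m u1 x a D : derives' (inr (Some D)) [::] u1 ->
  (forall u, meaning D [::] u -> meaning m (rcons u x) [:: a]) ->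
  derives' (inr (Some m)) (rcons u1 x) [:: a].
Proof.
move=> HD Hm; apply: (@even_odd_derives (ctx_rule (Some m, a, D, x))).
- exact: ctx_candidate.
- move=> u v [Hb Hl _].
  have /(cat_at1 sym_meaning (inl a)) -> := Hb _ (mem_head _ _).
  have [u2 [u3 [-> HDu /(cat_at1 sym_meaning (inl x)) ->]]] := Hl _ (mem_head _ _).
  by rewrite cats1; apply: Hm.
- split=> // alpha; rewrite inE => /eqP->.
    by apply/cat_at1; apply: derives_axiom.
  exists u1, [:: x]; rewrite cats1; split=> //.
  by apply/cat_at1; apply: derives_axiom.
Qed.

(** Induction on [size u + size v], then on [size v]: left halves and contexts decrease the sum,
    right halves keep it and decrease [size v]. *)
Lemma phrases_derived u v y : ~~ odd (size u) -> odd (size v) ->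
  (forall l n, left_exact l u -> derives' (inr (Some (exact_phrase l n u v y))) u v) /\
  (u = [::] -> derives' (inr (Some (prefix_phrase v y))) [::] v).
Proof.
have [N] := ubnP (size u + size v); elim: N u v y => // N IHN u v y ltN.
have [k] := ubnP (size v); elim: k u v y ltN => // k IHk u v y /ltnSE ltN /ltnSE ltk.
move=> even_u odd_v.
have splits l : left_exact l u -> splits_derived l u v y.
  move=> lu v1 a v2 n Ev odd1 odd2 l'.
  have szv : size v = (size v1 + size v2).+1 by rewrite Ev size_cat addnS.
  have szu : size (rcons (u ++ v1) a) = (size u + size v1).+1.
    by rewrite size_rcons size_cat.
  split.
    by have [||//|H _] := IHN u v1 a; [lia | | apply: H].
  have [|||//|H _] := IHk (rcons (u ++ v1) a) v2 y; try by rewrite ?szu; lia.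
  by apply: H; exists (u ++ v1).
have [v1|v_gt1] : (exists a, v = [:: a]) \/ 1 < size v.
  by case: (v) odd_v => [//|a [|b s]] _; [left; exists a | right].
  case: v1 => a Ev; subst v; split=> [l n lu|u0]; last first.
    by subst u; apply: no_ctx_derives; split.
  case: l lu => [[x T]|] lu; last first.
    have Eu : u = [::] := lu; subst u; apply: no_ctx_derives.
    exact: (facts_letter (l := None)).
  have [u1 [Eu ET]] := lu.
  (* As [u] has even length, [u1] has odd length, and its unconditional phrase can be placed under
     the context operator. *)
  have [|//||_ H] := IHN [::] u1 x.
  - by move: ltN; rewrite Eu size_rcons /=; lia.
  - by move: even_u; rewrite Eu size_rcons /= negbK.
  rewrite Eu; apply: (ctx_derives (H erefl)) => u' [_ /(_ (sub0set _)) sub].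
  rewrite -Eu; apply: facts_letter lu _; exists u'; split=> //.
  by rewrite ET; apply: prefix_facts_facts.
split=> [l n lu|u0].
  have D := splits l lu; apply: concat_derives.
    exact: derived_triples_neq0 D odd_v v_gt1.
  move=> u' v' /(derived_triples_meaning D odd_v v_gt1)[lu' H]; split=> // right_v.
  apply: facts_transfer => //; first exact: left_exact_same lu lu'.
  by right; split=> //; apply: H.
subst u; have D := splits None erefl; apply: concat_derives.
  exact: derived_triples_neq0 D odd_v v_gt1.
by move=> u' v' /(derived_triples_prefix D odd_v v_gt1)[-> sub]; split.
Qed.

(** * Equality of the languages *)

Lemma facts_derives X v y v' (c : bool) :
  facts derivable [::] v y \subset facts derivable [::] v' y ->
  derivable X [::] (v ++ nseq c y) -> derivable X [::] (v' ++ nseq c y).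
Proof.
move=> /factsP sub.
have E s : at_pos derivable (rcons s y) [:: X] 0 (size s + c) <->
    derivable X [::] (s ++ nseq c y).
  rewrite at_pos1 ?take0 ?drop0 ?size_rcons; last by case: c {sub}; lia.
  rewrite -cats1; case: (c); first by rewrite take_oversize // size_cat.
  by rewrite addn0 take_size_cat //= cats0.
by move=> /E H; apply/E; apply: (sub _ false c (items_singleton X) H).
Qed.

Lemma splits_derived_prefix v y : splits_derived None [::] v y.
Proof.
move=> v1 a v2 n _ odd1 odd2 l'; split.
  by have [//|//|H _] := @phrases_derived [::] v1 a; apply: H.
have [||H _] := @phrases_derived (rcons ([::] ++ v1) a) v2 y => //.
  by rewrite size_rcons /= negbK.
by apply: H; exists v1.
Qed.

Lemma even_odd_lang w : lang even_odd w <-> lang G w.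
Proof.
split=> [/even_odd_sound/(_ erefl)//|Hw].
case/lastP Ew: w => [|v y].
  apply: (@even_odd_derives empty_rule); first exact: empty_candidate.
    move=> u v [Hb _ _] _; have -> := Hb _ (mem_head _ _).
    by rewrite Ew in Hw.
  by split=> // alpha; rewrite inE => /eqP->.
have [odd_v|even_v] := boolP (odd (size v)).
  (* For even length the last letter is split off, and the facts about [v] extended by [y] speak of
     the whole string. *)
  apply: (@even_odd_derives (start_rule (prefix_phrase v y, y))).
  - exact: start_candidate.
  - move=> u v' [Hb _ _] u0; rewrite {}u0 in Hb.
    have [v1 [v2 [-> [_ sub] /(cat_at1 sym_meaning (inl y)) ->]]] := Hb _ (mem_head _ _).
    apply: (@facts_derives _ v y v1 true); first by apply: sub; apply: sub0set.
    by rewrite /= cats1 -Ew.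
  - split=> // alpha; rewrite inE => /eqP->; exists v, [:: y]; rewrite cats1.
    split=> //; last by apply/cat_at1; apply: derives_axiom.
    by have [//|//|_ H] := @phrases_derived [::] v y; apply: H.
rewrite -Ew; have odd_w : odd (size w) by rewrite Ew size_rcons.
have [[a Ea]|w_gt1] : (exists a, w = [:: a]) \/ 1 < size w.
    by case: (w) odd_w => [//|a [|b s]] _; [left; exists a | right].
  by rewrite Ea; apply: no_ctx_derives; rewrite -Ea.
(* Any letter could follow [w] here, since only facts about [w] itself are read off; [y] is at
   hand. *)
have D := @splits_derived_prefix w y.
apply: concat_derives; first exact: derived_triples_neq0 D odd_w w_gt1.
move=> u' v' /(derived_triples_prefix D odd_w w_gt1)[-> sub] _.
by have := @facts_derives (inr (start G)) _ _ _ false sub; rewrite !cats0; apply.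
Qed.

(** * Size bounds *)

Lemma grammar_size_gt0 : 0 < grammar_size G.
Proof. by rewrite /grammar_size addn1. Qed.

Lemma card_Sigma_lt : #|Sigma| < grammar_size G.
Proof. by rewrite /grammar_size addn1 ltnS -addnA leq_addr. Qed.

Lemma card_set_of (T : finType) : #|{set T}| = 2 ^ #|T|.
Proof. by rewrite -!cardsT -card_powerset powersetT. Qed.

(** With [g] the size of [G], the four components contribute [4g], [g], [2g] and [4g] to the
    exponent, and a last [g] absorbs the start symbol. *)
Lemma card_phrase : #|{: option phrase}| <= 2 ^ (12 * grammar_size G).
Proof.
have g_gt0 := grammar_size_gt0; have sg := card_Sigma_lt.
have mg := size_items G; move: (grammar_size G) g_gt0 sg mg => g g_gt0 sg mg.
have s_le : #|Sigma| <= 2 ^ g by apply: leq_trans (ltnW sg) (ltnW (ltn_expl _ _)).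
have succ_le n k : n <= 2 ^ (k * g) -> n.+1 <= 2 ^ (k.+1 * g).
  move=> nk; apply: (@leq_trans (2 ^ (k * g)).*2).
    by rewrite -addnn -addn1 leq_add // expn_gt0.
  by rewrite -mul2n -expnS leq_exp2l //; lia.
rewrite card_option; apply: (succ_le _ 11).
rewrite !card_prod card_option !card_prod !card_set_of !card_prod !card_bool card_ord.
have -> : 11 * g = 4 * g + g + 2 * g + 4 * g by lia.
rewrite (expnD _ (4 * g + g + 2 * g)) (expnD _ (4 * g + g)) (expnD _ (4 * g) g).
apply: leq_mul; last by rewrite leq_exp2l //; lia.
apply: leq_mul; last by rewrite leq_exp2l //; lia.
apply: leq_mul => //; apply: (succ_le _ 3).
by rewrite (mulSn 2 g) expnD; apply: leq_mul => //; rewrite leq_exp2l //; lia.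
Qed.

Lemma card_triples :
  #|{: phrase * Sigma * phrase}| <= 2 ^ (25 * grammar_size G).
Proof.
have := card_phrase; rewrite card_option => /ltnW ph.
have s_le : #|Sigma| <= 2 ^ grammar_size G.
  by apply: leq_trans (ltnW card_Sigma_lt) (ltnW (ltn_expl _ _)).
have -> : 25 * grammar_size G =
    12 * grammar_size G + grammar_size G + 12 * grammar_size G by lia.
rewrite (expnD _ (12 * grammar_size G + grammar_size G)).
rewrite (expnD _ (12 * grammar_size G) (grammar_size G)) card_prod.
by apply: leq_mul => //; rewrite card_prod; apply: leq_mul.
Qed.

Lemma rule_size_concat c : rule_size (concat_rule c) = 1 + 4 * #|c.2|.
Proof.
rewrite /rule_size !big_nil !addn0 big_map (eq_bigr (fun=> 4)) //.
by rewrite big_const_seq iter_addn_0 count_predT cardE.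
Qed.

Lemma candidates_size r : r \in candidates ->
  rule_size r <= 2 ^ (28 * grammar_size G).
Proof.
(* The factor 8 covers both [1 + 4 * n] for [n] triples and the rules of constant size. *)
move=> rc; apply: (@leq_trans (8 * 2 ^ (25 * grammar_size G))); last first.
  rewrite -[8]/(2 ^ 3) -expnD leq_exp2l //.
  by move: (grammar_size G) grammar_size_gt0 => g; lia.
have p1 : 0 < 2 ^ (25 * grammar_size G) by rewrite expn_gt0.
have small k : k <= 8 -> k <= 8 * 2 ^ (25 * grammar_size G).
  by move: (2 ^ _) p1 => b; nia.
move: r rc; apply: candidates_ind => [A T _|c|c|c|].
- rewrite rule_size_concat -[8]/(4 + 4) mulnDl leq_add //.
    by move: (2 ^ _) p1 => b; lia.
  by rewrite leq_mul2l (leq_trans (max_card _) card_triples).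
- by rewrite /rule_size !big_cons !big_nil small.
- by rewrite /rule_size !big_cons !big_nil small.
- by rewrite /rule_size !big_cons !big_nil small.
- by rewrite /rule_size !big_cons !big_nil small.
Qed.

(** Each of the five families of rules has at most [2 ^ 2 ^ (26 * g)] members, [g] being the size of
    [G]. *)
Lemma size_candidates : size candidates <= 5 * 2 ^ 2 ^ (26 * grammar_size G).
Proof.
have g_gt0 := grammar_size_gt0.
have s_le : #|Sigma| <= 2 ^ grammar_size G.
  by apply: leq_trans (ltnW card_Sigma_lt) (ltnW (ltn_expl _ _)).
have opt_le := card_phrase; have tri_le := card_triples.
have phr_le : #|{: phrase}| <= 2 ^ (12 * grammar_size G).
  by move: opt_le; rewrite card_option => /ltnW.
have -> : size candidates =
    #|[pred c : option phrase * {set phrase * Sigma * phrase} | c.2 != set0]| +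
    (#|{: option phrase * Sigma * phrase * Sigma}| +
     (#|{: option phrase * Sigma}| + (#|{: phrase * Sigma}| + 1))).
  by rewrite /candidates !size_cat !size_map !cardE !enumT.
have concat_le : #|[pred c : option phrase * {set phrase * Sigma * phrase} | c.2 != set0]|
    <= 2 ^ (12 * grammar_size G) * 2 ^ 2 ^ (25 * grammar_size G).
  apply: leq_trans (max_card _) _; rewrite card_prod card_set_of.
  by apply: leq_mul => //; rewrite leq_exp2l.
move: (grammar_size G) g_gt0 s_le opt_le tri_le phr_le concat_le =>
  g g_gt0 s_le opt_le tri_le phr_le concat_le.
have dbl_le n : n <= 2 ^ (26 * g) -> n <= 2 ^ 2 ^ (26 * g).
  by move=> /leq_trans; apply; apply: ltnW (ltn_expl _ _).
have le_concat : 2 ^ (12 * g) * 2 ^ 2 ^ (25 * g) <= 2 ^ 2 ^ (26 * g).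
  rewrite -expnD leq_exp2l //; have -> : 26 * g = 25 * g + g by lia.
  rewrite expnD; have : 2 <= 2 ^ g by rewrite -{1}[2]expn1 leq_exp2l.
  have : 25 * g < 2 ^ (25 * g) by apply: ltn_expl.
  by move: (2 ^ (25 * g)) (2 ^ g) => b c; nia.
have ctx_le : #|{: option phrase * Sigma * phrase * Sigma}| <= 2 ^ (26 * g).
  have -> : 26 * g = 12 * g + g + 12 * g + g by lia.
  rewrite (expnD _ (12 * g + g + 12 * g)) (expnD _ (12 * g + g)).
  rewrite (expnD _ (12 * g) g).
  by rewrite card_prod leq_mul // card_prod leq_mul // card_prod leq_mul.
have letter_le n : n <= 2 ^ (12 * g) -> n * #|Sigma| <= 2 ^ (26 * g).
  move=> le_n; apply: (@leq_trans (2 ^ (12 * g) * 2 ^ g)); first exact: leq_mul.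
  by rewrite -expnD leq_exp2l //; lia.
have no_ctx_le : #|{: option phrase * Sigma}| <= 2 ^ (26 * g).
  by rewrite card_prod letter_le.
have start_le : #|{: phrase * Sigma}| <= 2 ^ (26 * g).
  by rewrite card_prod letter_le.
have one_le : 1 <= 2 ^ 2 ^ (26 * g) by rewrite expn_gt0.
have -> k : 5 * k = k + (k + (k + (k + k))) by rewrite !mulSn mul0n addn0.
apply: leq_add; first exact: leq_trans concat_le le_concat.
apply: leq_add; first exact: (dbl_le _ ctx_le).
apply: leq_add; first exact: (dbl_le _ no_ctx_le).
apply: leq_add; [exact: (dbl_le _ start_le) | exact: one_le].
Qed.

Lemma even_odd_size : grammar_size even_odd <= 2 ^ 2 ^ (31 * grammar_size G).
Proof.
have g_gt0 := grammar_size_gt0; have s_lt := card_Sigma_lt.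
have opt_le := card_phrase; have cand_le := size_candidates.
have rules_le : \sum_(r <- sound_rules) rule_size r
    <= size candidates * 2 ^ (28 * grammar_size G).
  apply: (@leq_trans (\sum_(r <- sound_rules) 2 ^ (28 * grammar_size G))).
    rewrite big_seq [leqRHS]big_seq; apply: leq_sum => r.
    by rewrite mem_sound_rules => /andP[/candidates_size].
  rewrite big_const_seq iter_addn_0 count_predT mulnC leq_mul2r.
  rewrite size_seq_fset (leq_trans (size_undup _)) ?orbT //.
  by rewrite size_filter count_size.
have -> : grammar_size even_odd =
  #|Sigma| + #|{: option phrase}| + \sum_(r <- sound_rules) rule_size r + 1 by [].
move: (grammar_size G) g_gt0 s_lt opt_le cand_le rules_le =>
  g g_gt0 s_lt opt_le cand_le rules_le.
have dbl_le k : k <= 28 -> 2 ^ (k * g) <= 2 ^ 2 ^ (28 * g).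
  move=> k_le; apply: leq_trans (_ : 2 ^ (28 * g) <= _).
    by rewrite leq_exp2l // leq_mul2r k_le orbT.
  exact: ltnW (ltn_expl _ _).
have g_le : g <= 2 ^ 2 ^ (28 * g).
  have := dbl_le 1 isT; rewrite mul1n.
  exact: leq_trans (ltnW (ltn_expl g (ltnSn 1))).
have le26 : 2 ^ 2 ^ (26 * g) <= 2 ^ 2 ^ (28 * g).
  by rewrite !leq_exp2l // leq_mul2r orbT.
(* With [b = 2 ^ 2 ^ (28 * g)] the rules take at most [5 * b ^ 2] and everything else at most
   [2 * b]; 8 is the next power of two. *)
have le_final : 8 * (2 ^ 2 ^ (28 * g) * 2 ^ 2 ^ (28 * g)) <= 2 ^ 2 ^ (31 * g).
  rewrite -expnD -[8]/(2 ^ 3) -expnD leq_exp2l //.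
  have -> : 31 * g = 3 * g + 28 * g by lia.
  rewrite expnD; have : 2 ^ 3 <= 2 ^ (3 * g) by rewrite leq_exp2l //; lia.
  have : 0 < 2 ^ (28 * g) by rewrite expn_gt0.
  by rewrite -[2 ^ 3]/8; move: (2 ^ (28 * g)) (2 ^ (3 * g)) => b c; nia.
apply: leq_trans le_final.
have := dbl_le 12 isT; have := dbl_le 28 isT; have : 0 < 2 ^ 2 ^ (28 * g).
  by rewrite expn_gt0.
move: opt_le cand_le rules_le s_lt g_le le26.
move: (2 ^ (12 * g)) (2 ^ 2 ^ (26 * g)) (2 ^ 2 ^ (28 * g)) => e c b.
move: (2 ^ (28 * g)) => d; move: (size _) (\sum_(r <- _) _) => k R.
move=> e_le k_le R_le s_lt g_le c_le b_gt0 d_le e_le'.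
have b_le : b <= b * b by rewrite leq_pmulr.
have : k * d <= 5 * (b * b).
  by rewrite mulnA leq_mul // (leq_trans k_le) // leq_mul2l.
move: #|_| e_le #|Sigma| s_lt => o e_le s s_lt.
by move: (k * d) (b * b) R_le b_le => kd b2; lia.
Qed.

End Construction.

(** * The bounds as towers, and the theorem *)

Lemma leq_tower k n : n <= tower k n.
Proof. by elim: k => //= k IH; apply: leq_trans IH (ltnW (ltn_expl _ _)). Qed.

Theorem theorem1 :
  exists p q : {poly nat},
    forall (Sigma : finType) (G : grammar Sigma),
      exists G' : grammar Sigma,
        [/\ even_odd_nf G',
            forall w : seq Sigma, lang G' w <-> lang G w,
            grammar_size G' <= tower 6 (p.[grammar_size G])%R
          & strong_binary_nf G ->
            grammar_size G' <= tower 2 (q.[grammar_size G])%R].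
Proof.
pose p : {poly nat} := ((31 : nat)%:P * 'X)%R.
have pE x : (p.[x])%R = 31 * x by rewrite hornerMX hornerC.
exists p, p => Sigma G; exists (even_odd G).
split; [exact: even_odd_normal | exact: even_odd_lang | rewrite pE | move=> _; rewrite pE].
  (* [tower 6 n] is convertible to [tower 4 (2 ^ 2 ^ n)]. *)
  exact: leq_trans (even_odd_size G) (leq_tower 4 _).
exact: even_odd_size.
Qed.
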